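(* Let $n,N\ge1$ and positive integers $r_1,\dots,r_N,r$ with $r_i\le r\le\lfloor(n-1)/2\rfloor$. Consider either (a) $d=n$, $m=r_i$, $p=r_i+1$, $q=n-r_i$ for some $i$, $\mathcal{A}(y)=\mathcal{H}_{r_i+1}(y)$; or (b) $d=Nn$, $m=r$, $p=r+1$, $q=N(n-r)$, $\mathcal{A}(y)=[\mathcal{H}_{r+1}(y_1)\cdots\mathcal{H}_{r+1}(y_N)]$ for $y=(y_1^\top,\dots,y_N^\top)^\top$. Fix $\hat y\in\mathbb{R}^d$, let $\Psi(R)=\inf_{y}\{\frac12\|y-\hat y\|^2: R\mathcal{A}(y)=0\}$ for $R\in\mathbb{R}^{1\times p}$, let $\Theta=\{R\in\mathbb{R}^{1\times p}:RR^\top=1\}$ and $\widetilde\Psi=\Psi+\delta_\Theta$. Let $R^*$ be a stationary point of $\widetilde\Psi$ (i.e. $0\in\partial\widetilde\Psi(R^* )$) and let $y^*$ attain the infimum defining $\Psi(R^* )$. Then $$0\in y^*-\hat y+\mathcal{A}^*\big(N_{\{X:\mathrm{rank}(X)\le m\}}(\mathcal{A}(y^* ))\big).$$ If in addition $\mathrm{rank}(\mathcal{A}(y^* ))=m$, then $$0\in y^*-\hat y+N_{\{y:\mathrm{rank}(\mathcal{A}(y))\le m\}}(y^* ).$$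
   Context: For $x\in\mathbb{R}^n$ and $1\le l\le n$, $\mathcal{H}_l(x)\in\mathbb{R}^{l\times(n-l+1)}$ is the Hankel matrix with $(i,j)$ entry $x(i+j-1)$. $\delta_\Theta$ is the indicator function of $\Theta$; $\partial$ denotes the limiting subdifferential and $N_S(x)$ the limiting normal cone of a closed set $S$ at $x$ (Rockafellar–Wets); $\mathcal{A}^*$ is the adjoint of $\mathcal{A}$ with respect to the Frobenius inner product. *)

(* Defs.v *)
From HB Require Import structures.
From mathcomp Require Import all_boot all_order all_algebra.
From mathcomp Require Import all_classical all_reals ereal.
Set Implicit Arguments. Unset Strict Implicit. Unset Printing Implicit Defensive.
Import Order.TTheory GRing.Theory Num.Theory.
Local Open Scope ring_scope.
Local Open Scope classical_set_scope.

Section Defs.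
Variable R : realType.

Definition frob {a b} (A B : 'M[R]_(a, b)) : R :=
  \sum_(i < a) \sum_(j < b) A i j * B i j.
Definition fnorm {a b} (A : 'M[R]_(a, b)) : R := Num.sqrt (frob A A).

Definition cvg_mx {a b} (xs : nat -> 'M[R]_(a, b)) (x : 'M[R]_(a, b)) : Prop :=
  forall eps : R, 0 < eps -> exists K : nat, forall k, (K <= k)%N ->
    fnorm (xs k - x) < eps.

Definition frechet_normal {a b} (S : set 'M[R]_(a, b)) (x v : 'M[R]_(a, b)) : Prop :=
  S x /\ forall eps : R, 0 < eps -> exists delta : R, 0 < delta /\
    forall z, S z -> fnorm (z - x) < delta -> frob v (z - x) <= eps * fnorm (z - x).

(* limiting (Mordukhovich) normal cone N_S(x) (Rockafellar-Wets 6.3) *)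
Definition limiting_normal {a b} (S : set 'M[R]_(a, b)) (x : 'M[R]_(a, b)) :
  set 'M[R]_(a, b) :=
  [set v | S x /\ exists (xs vs : nat -> 'M[R]_(a, b)),
     [/\ cvg_mx xs x, cvg_mx vs v & forall k, frechet_normal S (xs k) (vs k)]].

Definition frechet_subgrad {a b} (f : 'M[R]_(a, b) -> \bar R) (x v : 'M[R]_(a, b)) : Prop :=
  f x \is a fin_num /\ forall eps : R, 0 < eps -> exists delta : R, 0 < delta /\
    forall z, fnorm (z - x) < delta ->
      (f x + (frob v (z - x) - eps * fnorm (z - x))%:E <= f z)%E.

(* limiting subdifferential (Rockafellar-Wets 8.3): x_k -> x, f x_k -> f x,
   v_k regular subgradients at x_k, v_k -> v *)
Definition limiting_subdiff {a b} (f : 'M[R]_(a, b) -> \bar R) (x : 'M[R]_(a, b)) :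
  set 'M[R]_(a, b) :=
  [set v | f x \is a fin_num /\ exists (xs vs : nat -> 'M[R]_(a, b)),
     [/\ cvg_mx xs x, cvg_mx vs v,
         (forall eps : R, 0 < eps -> exists K : nat, forall k, (K <= k)%N ->
             `| fine (f (xs k)) - fine (f x) | < eps)
       & forall k, frechet_subgrad f (xs k) (vs k)]].

Definition vget {d} (x : 'cV[R]_d) (k : nat) : R :=
  match @insub _ (fun i => (i < d)%N) 'I_d k with Some i => x i 0 | None => 0 end.

(* Hankel matrix H_l(x) in R^{l x (n-l+1)}, (i,j) entry x(i+j-1) (1-indexed) *)
Definition hankel {n} (l : nat) (x : 'cV[R]_n) : 'M[R]_(l, n - l + 1) :=
  \matrix_(i < l, j < n - l + 1) vget x (i + j).

(* [H_{r+1}(y_1) ... H_{r+1}(y_N)] for y = (y_1^T,...,y_N^T)^T in R^{N n};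
   column j = k (n-r) + c is column c of the k-th block *)
Definition block_hankel (n N r : nat) (y : 'cV[R]_(N * n)) : 'M[R]_(r.+1, N * (n - r)) :=
  \matrix_(i < r.+1, j < N * (n - r))
     vget y ((j %/ (n - r)) * n + (i + j %% (n - r))).

Definition adjoint {d p q} (A : 'cV[R]_d -> 'M[R]_(p, q)) (X : 'M[R]_(p, q)) : 'cV[R]_d :=
  \col_(k < d) frob (A (delta_mx k 0)) X.

Definition Psi {d p q} (A : 'cV[R]_d -> 'M[R]_(p, q)) (yhat : 'cV[R]_d)
  (Rm : 'M[R]_(1, p)) : \bar R :=
  ereal_inf [set ((2%:R)^-1 * fnorm (y - yhat) ^+ 2)%:E | y in [set y | Rm *m A y = 0]].

Definition Theta {p} : set 'M[R]_(1, p) := [set Rm | Rm *m Rm^T = 1%:M].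
Definition indicator {a b} (S : set 'M[R]_(a, b)) (x : 'M[R]_(a, b)) : \bar R :=
  if `[< S x >] then 0%E else +oo%E.

Definition Psi_tilde {d p q} (A : 'cV[R]_d -> 'M[R]_(p, q)) (yhat : 'cV[R]_d)
  (Rm : 'M[R]_(1, p)) : \bar R := (Psi A yhat Rm + indicator Theta Rm)%E.

Definition stationary_claim (d p q m : nat) (A : 'cV[R]_d -> 'M[R]_(p, q)) : Prop :=
  forall (yhat : 'cV[R]_d) (Rstar : 'M[R]_(1, p)) (ystar : 'cV[R]_d),
    limiting_subdiff (Psi_tilde A yhat) Rstar 0 ->
    Rstar *m A ystar = 0 ->
    ((2%:R)^-1 * fnorm (ystar - yhat) ^+ 2)%:E = Psi A yhat Rstar ->
    (exists2 W, limiting_normal [set X : 'M[R]_(p, q) | (\rank X <= m)%N] (A ystar) W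
                & ystar - yhat + adjoint A W = 0)
    /\ ((\rank (A ystar) = m) ->
        exists2 v, limiting_normal [set y : 'cV[R]_d | (\rank (A y) <= m)%N] ystar v
                 & ystar - yhat + v = 0).

End Defs.
Arguments stationary_claim {R} d p q m A.
Arguments block_hankel {R} n N r y.

(* Main.v *)
Require Import Defs.
From HB Require Import structures.
From mathcomp Require Import all_boot all_order all_algebra.
From mathcomp Require Import all_classical all_reals ereal.
From mathcomp Require Import topology normedtype sequences.
From mathcomp Require Import ring lra zify.
Import Order.TTheory GRing.Theory Num.Theory.
Import numFieldNormedType.Exports.
Local Open Scope ring_scope.
Local Open Scope classical_set_scope.
Set Implicit Arguments. Unset Strict Implicit. Unset Printing Implicit Defensive.

(** Write R', y' for the stationary point and its minimizer, A* for the adjoint.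
    For every R <> 0 the map l |-> A* (R^T l) is injective, so the problem
    defining Psi(R) has a unique solution y_R, with a unique multiplier l_R that
    depends continuously on R, and y_R - yhat + A* (R^T l_R) = 0.  Weak duality
    gives Psi(z) - Psi(R) <= <l_z A(yhat - A* (R^T l_z))^T, z - R>, hence a
    regular subgradient v of Psi + delta_Theta at R satisfies
    l_R A(y_R)^T = v - <v, R> R.  Letting v -> 0 along R_k -> R' yields
    l A(y')^T = 0 for l = l_{R'}.  Thus W = R'^T l has rank at most one and is
    orthogonal to A(y') on both sides, which makes it a limiting normal of
    {rank <= m} at A(y'): it is a regular normal at matrices of rank exactly m
    that are annihilated by R' and l, and these accumulate at A(y'). *)

(** * Frobenius inner product and norm *)

Section Frobenius.
Variable R : realType.

Lemma frobE a b (A B : 'M[R]_(a, b)) : frob A B = \tr (A *m B^T).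
Proof.
rewrite /frob /mxtrace; apply: eq_bigr => i _; rewrite mxE.
by apply: eq_bigr => j _; rewrite mxE.
Qed.

Lemma frobC a b (A B : 'M[R]_(a, b)) : frob A B = frob B A.
Proof. by apply: eq_bigr => i _; apply: eq_bigr => j _; rewrite mulrC. Qed.

Lemma frobDl a b (A B C : 'M[R]_(a, b)) : frob (A + B) C = frob A C + frob B C.
Proof. by rewrite !frobE mulmxDl mxtraceD. Qed.

Lemma frobDr a b (A B C : 'M[R]_(a, b)) : frob C (A + B) = frob C A + frob C B.
Proof. by rewrite frobC frobDl !(frobC C). Qed.

Lemma frobZl a b t (A B : 'M[R]_(a, b)) : frob (t *: A) B = t * frob A B.
Proof. by rewrite !frobE -scalemxAl mxtraceZ. Qed.

Lemma frobZr a b t (A B : 'M[R]_(a, b)) : frob A (t *: B) = t * frob A B.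
Proof. by rewrite frobC frobZl frobC. Qed.

Lemma frobNl a b (A B : 'M[R]_(a, b)) : frob (- A) B = - frob A B.
Proof. by rewrite -scaleN1r frobZl mulN1r. Qed.

Lemma frobNr a b (A B : 'M[R]_(a, b)) : frob A (- B) = - frob A B.
Proof. by rewrite frobC frobNl frobC. Qed.

Lemma frob0r a b (A : 'M[R]_(a, b)) : frob A 0 = 0.
Proof. by rewrite -[0](scale0r 0) frobZr mul0r. Qed.

Lemma frob0l a b (A : 'M[R]_(a, b)) : frob 0 A = 0.
Proof. by rewrite frobC frob0r. Qed.

Lemma frob_mull a b c (A : 'M[R]_(a, b)) (B : 'M[R]_(b, c)) C :
  frob (A *m B) C = frob B (A^T *m C).
Proof. by rewrite !frobE trmx_mul trmxK mulmxA -mulmxA mxtrace_mulC. Qed.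

Lemma frob_mulr a b c (A : 'M[R]_(a, b)) (B : 'M[R]_(b, c)) C :
  frob (A *m B) C = frob A (C *m B^T).
Proof. by rewrite !frobE trmx_mul trmxK mulmxA. Qed.

Lemma frob_tr a b (A B : 'M[R]_(a, b)) : frob A^T B^T = frob A B.
Proof. by rewrite !frobE trmxK mxtrace_mulC -mxtrace_tr trmx_mul trmxK. Qed.

Lemma mul_rV_tr a (u v : 'rV[R]_a) : u *m v^T = (frob u v)%:M.
Proof. by rewrite [LHS]mx11_scalar frobE /mxtrace big_ord1. Qed.

Lemma Theta_frob a (r : 'rV[R]_a) : Theta r <-> frob r r = 1.
Proof.
rewrite /Theta /= mul_rV_tr; split=> [/matrixP/(_ 0 0)|->//].
by rewrite !mxE !mulr1n.
Qed.

Lemma Theta_neq0 a (r : 'rV[R]_a) : Theta r -> r != 0.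
Proof.
move=> /Theta_frob rr; apply/eqP => h; move: rr.
by rewrite h frob0l => /esym/eqP; rewrite oner_eq0.
Qed.

Lemma frob_ge0 a b (A : 'M[R]_(a, b)) : 0 <= frob A A.
Proof.
by apply: sumr_ge0 => i _; apply: sumr_ge0 => j _; rewrite -expr2 sqr_ge0.
Qed.

Lemma fnorm_ge0 a b (A : 'M[R]_(a, b)) : 0 <= fnorm A.
Proof. exact: sqrtr_ge0. Qed.

Lemma sqr_fnorm a b (A : 'M[R]_(a, b)) : fnorm A ^+ 2 = frob A A.
Proof. by rewrite sqr_sqrtr ?frob_ge0. Qed.

Lemma frob_eq0 a b (A : 'M[R]_(a, b)) : frob A A = 0 -> A = 0.
Proof.
move=> h; apply/matrixP => i j; rewrite mxE; apply/eqP; rewrite -sqrf_eq0 expr2.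
have := h => /eqP; rewrite psumr_eq0; last first.
  by move=> k _; apply: sumr_ge0 => l _; rewrite -expr2 sqr_ge0.
move=> /allP/(_ i); rewrite mem_index_enum => /(_ isT) /=.
rewrite psumr_eq0; last by move=> l _; rewrite -expr2 sqr_ge0.
by move=> /allP/(_ j); rewrite mem_index_enum => /(_ isT).
Qed.

Lemma fnorm_eq0 a b (A : 'M[R]_(a, b)) : fnorm A = 0 -> A = 0.
Proof. by move=> h; apply: frob_eq0; rewrite -sqr_fnorm h expr0n. Qed.

Lemma fnorm0 a b : fnorm (0 : 'M[R]_(a, b)) = 0.
Proof. by rewrite /fnorm frob0l sqrtr0. Qed.

Lemma fnormZ a b t (A : 'M[R]_(a, b)) : fnorm (t *: A) = `|t| * fnorm A.
Proof.
by rewrite /fnorm frobZl frobZr mulrA -expr2 sqrtrM ?sqr_ge0 // sqrtr_sqr.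
Qed.

Lemma fnormN a b (A : 'M[R]_(a, b)) : fnorm (- A) = fnorm A.
Proof. by rewrite /fnorm frobNl frobNr opprK. Qed.

Lemma frob_le a b (A B : 'M[R]_(a, b)) : frob A B <= fnorm A * fnorm B.
Proof.
have [/eqP/fnorm_eq0->|A0] := boolP (fnorm A == 0).
  by rewrite frob0l fnorm0 mul0r.
have [/eqP/fnorm_eq0->|B0] := boolP (fnorm B == 0).
  by rewrite frob0r fnorm0 mulr0.
have p0 : 0 < fnorm A * fnorm B by rewrite mulr_gt0 // lt0r fnorm_ge0 ?A0 ?B0.
rewrite -(ler_pM2l p0).
have := frob_ge0 (fnorm B *: A - fnorm A *: B).
rewrite !(frobDl, frobDr, frobNl, frobNr, frobZl, frobZr) (frobC B A) -!sqr_fnorm.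
nra.
Qed.

Lemma fnormD a b (A B : 'M[R]_(a, b)) : fnorm (A + B) <= fnorm A + fnorm B.
Proof.
rewrite -(@ler_pXn2r _ 2) ?nnegrE ?addr_ge0 ?fnorm_ge0 //.
rewrite sqr_fnorm frobDl !frobDr (frobC B A) -!sqr_fnorm.
have := frob_le A B; nra.
Qed.

(** Each entry of the product is an inner product of a row of [A] with a row of [B^T];
    Cauchy-Schwarz for every entry and summation of the squares give the bound. *)
Lemma fnormM a b c (A : 'M[R]_(a, b)) (B : 'M[R]_(b, c)) :
  fnorm (A *m B) <= fnorm A * fnorm B.
Proof.
rewrite -(@ler_pXn2r _ 2) ?nnegrE ?mulr_ge0 ?fnorm_ge0 //.
rewrite exprMn !sqr_fnorm {1 2}/frob mulr_suml; apply: ler_sum => i _.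
rewrite -[frob B B]frob_tr mulr_sumr; apply: ler_sum => j _.
have rowE k (u v : 'rV[R]_k) : frob u v = \sum_l u 0 l * v 0 l.
  by rewrite /frob big_ord1.
have -> : (A *m B) i j = frob (row i A) (row j B^T).
  by rewrite rowE mxE; apply: eq_bigr => k _; rewrite !mxE.
have -> : \sum_j0 A i j0 * A i j0 = fnorm (row i A) ^+ 2.
  by rewrite sqr_fnorm rowE; apply: eq_bigr => k _; rewrite !mxE.
have -> : \sum_i0 B^T j i0 * B^T j i0 = fnorm (row j B^T) ^+ 2.
  by rewrite sqr_fnorm rowE; apply: eq_bigr => k _; rewrite !mxE.
rewrite -exprMn -expr2 -[leLHS](real_normK (num_real _)) ler_pXn2r
  ?nnegrE ?mulr_ge0 ?fnorm_ge0 //.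
by rewrite ler_norml frob_le andbT lerNl -frobNl -(fnormN (row i A)) frob_le.
Qed.

Lemma entry_le_fnorm a b (A : 'M[R]_(a, b)) i j : `|A i j| <= fnorm A.
Proof.
rewrite -(@ler_pXn2r _ 2) ?nnegrE ?fnorm_ge0 // sqr_fnorm.
rewrite (real_normK (num_real _)) /frob.
rewrite (bigD1 i) //= (bigD1 j) //= -expr2 -addrA lerDl addr_ge0 ?sumr_ge0 //.
  by move=> k _; rewrite -expr2 sqr_ge0.
by move=> k _; rewrite sumr_ge0 // => l _; rewrite -expr2 sqr_ge0.
Qed.

Lemma fnorm_sum a b I (s : seq I) (F : I -> 'M[R]_(a, b)) :
  fnorm (\sum_(i <- s) F i) <= \sum_(i <- s) fnorm (F i).
Proof.
elim/big_rec2 : _ => [|i x y _ h]; first by rewrite fnorm0.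
by apply: le_trans (fnormD _ _) _; rewrite lerD2l.
Qed.

Lemma linear_bounded a b c d (f : {linear 'M[R]_(a, b) -> 'M[R]_(c, d)}) :
  exists2 C : R, 0 < C & forall x, fnorm (f x) <= C * fnorm x.
Proof.
(* The added 1 keeps the constant positive, so that it can be divided by. *)
exists (1 + \sum_(i < a) \sum_(j < b) fnorm (f (delta_mx i j))).
  rewrite ltr_pwDl // sumr_ge0 // => i _; rewrite sumr_ge0 // => j _.
  exact: fnorm_ge0.
move=> x; rewrite {1}(matrix_sum_delta x) linear_sum.
apply: le_trans (fnorm_sum _ _) _.
rewrite mulrDl mul1r ler_wpDl ?fnorm_ge0 // mulr_suml ler_sum // => i _.
rewrite linear_sum; apply: le_trans (fnorm_sum _ _) _.
rewrite mulr_suml ler_sum // => j _.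
by rewrite linearZ fnormZ mulrC ler_wpM2l ?fnorm_ge0 ?entry_le_fnorm.
Qed.

Lemma gram_unitmx a b (B : 'M[R]_(a, b)) :
  (forall u : 'rV_a, u *m B = 0 -> u = 0) -> B *m B^T \in unitmx.
Proof.
move=> injB; rewrite -row_free_unit; apply/row_freeP.
apply/row_freeP; apply: inj_row_free => u uB; apply: injB; apply: frob_eq0.
by rewrite frob_mulr -mulmxA uB frob0r.
Qed.

End Frobenius.

(** * Limits of matrix sequences *)

Section Convergence.
Variable R : realType.

Lemma cvg_mxP a b (xs : nat -> 'M[R]_(a, b)) x :
  cvg_mx xs x <-> forall i j, xs k i j @[k --> \oo] --> x i j.
Proof.
split=> [h i j|h].
  apply/cvgrPdist_lt => e e0; have [K hK] := h _ e0.
  exists K => // k /= Kk; apply: le_lt_trans (hK _ Kk).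
  by rewrite distrC -[_ - _](_ : (xs k - x) i j = _) ?entry_le_fnorm // !mxE.
move=> e e0.
have : fnorm (xs k - x) ^+ 2 @[k --> \oo] --> (0 : R).
  rewrite (_ : 0 = \sum_(i < a) \sum_(j < b) (x i j - x i j) * (x i j - x i j)).
    under eq_fun do rewrite sqr_fnorm /frob.
    apply: cvg_big => // [|i _]; first exact: add_continuous.
    apply: cvg_big => // [|j _]; first exact: add_continuous.
    by under eq_fun do rewrite !mxE; apply: cvgM; apply: cvgB => //; apply: cvg_cst.
  by rewrite big1 // => i _; rewrite big1 // => j _; rewrite subrr mul0r.
move=> /cvgrPdist_lt/(_ _ (exprn_gt0 2 e0)) [K _ hK]; exists K => k Kk.
move: (hK k Kk); rewrite /= sub0r normrN normrX (ger0_norm (fnorm_ge0 _)).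
by rewrite ltr_pXn2r ?nnegrE ?fnorm_ge0 ?ltW.
Qed.

Lemma cvg_mx_cst a b (x : 'M[R]_(a, b)) : cvg_mx (fun=> x) x.
Proof. by move=> e e0; exists 0%N => k _; rewrite subrr fnorm0. Qed.

Lemma cvg_mxD a b (xs ys : nat -> 'M[R]_(a, b)) x y :
  cvg_mx xs x -> cvg_mx ys y -> cvg_mx (fun k => xs k + ys k) (x + y).
Proof.
move=> /cvg_mxP hx /cvg_mxP hy; apply/cvg_mxP => i j.
by rewrite mxE; under eq_fun do rewrite mxE; apply: cvgD.
Qed.

Lemma cvg_mxZ a b (ts : nat -> R) (xs : nat -> 'M[R]_(a, b)) (t : R) x :
  ts k @[k --> \oo] --> t -> cvg_mx xs x -> cvg_mx (fun k => ts k *: xs k) (t *: x).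
Proof.
move=> ht /cvg_mxP hx; apply/cvg_mxP => i j.
by rewrite mxE; under eq_fun do rewrite mxE; apply: cvgM.
Qed.

Lemma cvg_mxN a b (xs : nat -> 'M[R]_(a, b)) x :
  cvg_mx xs x -> cvg_mx (fun k => - xs k) (- x).
Proof.
move=> /cvg_mxP hx; apply/cvg_mxP => i j.
by rewrite mxE; under eq_fun do rewrite mxE; apply: cvgN.
Qed.

Lemma cvg_mx_tr a b (xs : nat -> 'M[R]_(a, b)) x :
  cvg_mx xs x -> cvg_mx (fun k => (xs k)^T) x^T.
Proof.
move=> /cvg_mxP hx; apply/cvg_mxP => i j.
by rewrite mxE; under eq_fun do rewrite mxE; exact: hx.
Qed.

Lemma cvg_mxM a b c (xs : nat -> 'M[R]_(a, b)) (ys : nat -> 'M[R]_(b, c)) x y :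
  cvg_mx xs x -> cvg_mx ys y -> cvg_mx (fun k => xs k *m ys k) (x *m y).
Proof.
move=> /cvg_mxP hx /cvg_mxP hy; apply/cvg_mxP => i j.
rewrite mxE; under eq_fun do rewrite mxE.
by apply: cvg_big => // [|k _]; [exact: add_continuous | apply: cvgM].
Qed.

Lemma cvg_frob a b (xs ys : nat -> 'M[R]_(a, b)) x y :
  cvg_mx xs x -> cvg_mx ys y -> frob (xs k) (ys k) @[k --> \oo] --> frob x y.
Proof.
move=> /cvg_mxP hx /cvg_mxP hy; rewrite /frob.
apply: cvg_big => // [|i _]; first exact: add_continuous.
by apply: cvg_big => // [|j _]; [exact: add_continuous | apply: cvgM].
Qed.

Lemma cvg_mx_linear a b c d (f : {linear 'M[R]_(a, b) -> 'M[R]_(c, d)}) xs x :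
  cvg_mx xs x -> cvg_mx (fun k => f (xs k)) (f x).
Proof.
have [C C0 hC] := linear_bounded f; move=> hx e e0.
have [K hK] := hx _ (divr_gt0 e0 C0); exists K => k /hK.
rewrite ltr_pdivlMr // mulrC; apply: le_lt_trans.
by rewrite -linearB hC.
Qed.

Lemma cvg_mx_unique a b (xs : nat -> 'M[R]_(a, b)) x y :
  cvg_mx xs x -> cvg_mx xs y -> x = y.
Proof.
move=> /cvg_mxP hx /cvg_mxP hy; apply/matrixP => i j.
exact: cvg_unique (hx i j) (hy i j).
Qed.

(** Since [xs k^-1 - x^-1 = - xs k^-1 (xs k - x) x^-1], it suffices to bound the inverses
    [xs k^-1]. *)
Lemma cvg_invmx a (xs : nat -> 'M[R]_a) x :
  x \in unitmx -> (forall k, xs k \in unitmx) -> cvg_mx xs x ->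
  cvg_mx (fun k => invmx (xs k)) (invmx x).
Proof.
move=> ux uxs hx e e0; set b := fnorm (invmx x).
have b0 : 0 <= b by exact: fnorm_ge0.
have D0 : 0 < 2 * (b + 1) ^+ 2 by nra.
(* The first bound on [t = |xs k - x|] yields [|xs k^-1| <= 2 b]; the second then makes the error,
   at most [2 b^2 t], smaller than [e]. Using [b + 1] avoids a division by zero. *)
have m0 : 0 < Num.min (2 * (b + 1))^-1 (e / (2 * (b + 1) ^+ 2)).
  by rewrite lt_min divr_gt0 // invr_gt0 mulr_gt0 // ltr_wpDl.
have [K hK] := hx _ m0; exists K => k /hK; rewrite lt_min => /andP[].
rewrite -div1r ltr_pdivlMr; last by nra.
rewrite ltr_pdivlMr //.
have -> : invmx (xs k) - invmx x = - (invmx (xs k) *m (xs k - x) *m invmx x).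
  by rewrite mulmxBr mulVmx // mulmxBl mul1mx mulmxK // opprB.
rewrite fnormN; set t := fnorm (xs k - x); set s := fnorm (_ *m _).
have t0 : 0 <= t by exact: fnorm_ge0.
set c := fnorm (invmx (xs k)); have c0 : 0 <= c by exact: fnorm_ge0.
have s0 : 0 <= s by exact: fnorm_ge0.
have sle : s <= c * t * b.
  apply: le_trans (fnormM _ _) _; rewrite ler_wpM2r //; exact: fnormM.
have cle : c <= b + s.
  have -> : c = fnorm (invmx x - invmx (xs k) *m (xs k - x) *m invmx x).
    by rewrite mulmxBr mulVmx // mulmxBl mul1mx mulmxK // opprB addrC subrK.
  by apply: le_trans (fnormD _ _) _; rewrite fnormN.
move=> h1 h2.
have h3 : t * b <= 1 / 2 by nra.
have c2 : c <= 2 * b.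
  by have : c * (t * b) <= c * (1 / 2) by [exact: ler_wpM2l]; lra.
have : c * (t * b) <= 2 * b * (t * b) by rewrite ler_wpM2r // mulr_ge0.
nra.
Qed.

End Convergence.

(** * Normals to the set of matrices of bounded rank *)

Section RankNormals.
Variable R : realType.

Lemma row_free_annihilator (F : fieldType) m p (a : 'cV[F]_p) :
  (m < p)%N -> exists2 U : 'M[F]_(m, p), row_free U & U *m a = 0.
Proof.
move=> mp; have mr : (m <= \rank (kermx a))%N.
  rewrite mxrank_ker leq_subRL; last exact: rank_leq_row.
  by apply: leq_trans mp; rewrite -[m.+1]add1n leq_add2r rank_leq_col.
exists (pid_mx m *m row_base (kermx a)).
  rewrite /row_free mxrankMfree ?row_base_free // rank_pid_mx //.
by apply/sub_kermxP; rewrite (submx_trans (submxMl _ _)) // eq_row_base.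
Qed.

(** A nonzero polynomial has fewer than [size p] roots, so one of the [size p] distinct numbers
    [e / (i + 2)] is not a root. *)
Lemma exists_small_nonroot (F : realFieldType) (p : {poly F}) (e : F) :
  p != 0 -> 0 < e -> exists t, [/\ 0 < t, t < e & ~~ root p t].
Proof.
move=> p0 e0; pose u (i : nat) : F := e / i.+2%:R.
have uE i : 0 < u i < e.
  by rewrite divr_gt0 //= ltr_pdivrMr // ltr_pMr // ltr1n.
have [/allP h|/allPn[t /mapP[i _ ->] nt]] :=
  boolP (all (root p) [seq u i | i <- iota 0 (size p)]).
  have uu : uniq [seq u i | i <- iota 0 (size p)].
    rewrite map_inj_uniq ?iota_uniq // => i j /(mulfI (lt0r_neq0 e0))/invr_inj.
    by move=> /eqP; rewrite eqr_nat => /eqP[].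
  by have := max_poly_roots p0 (introT allP h) uu; rewrite size_map size_iota ltnn.
by exists (u i); have /andP[] := uE i.
Qed.

(** Take [Y = X + t N] with [N = U^T V], the rows of [U] orthogonal to [r] and those of [V] to [l],
    so that both annihilators survive. The compression [U Y V^T = D (t - B)] is invertible unless
    [t] is an eigenvalue of [B], which some small [t] avoids; hence the rank is at least [m], and
    [r Y = 0] bounds it by [m]. *)
Lemma rank_perturbation m q (r : 'rV[R]_m.+1) (l : 'rV[R]_q)
    (X : 'M[R]_(m.+1, q)) (e : R) :
  (m < q)%N -> r != 0 -> r *m X = 0 -> X *m l^T = 0 -> 0 < e ->
  exists Y : 'M[R]_(m.+1, q),
    [/\ fnorm (Y - X) < e, r *m Y = 0, Y *m l^T = 0 & \rank Y = m].
Proof.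
move=> mq r0 rX Xl e0.
have [U fU Ur] := row_free_annihilator r^T (ltnSn m).
have [V fV Vl] := row_free_annihilator l^T mq.
have gram a b (B : 'M[R]_(a, b)) : row_free B -> B *m B^T \in unitmx.
  by move=> fB; apply: gram_unitmx => u uB; apply: (row_free_inj fB); rewrite mul0mx.
pose D := (U *m U^T) *m (V *m V^T).
have uD : D \in unitmx by rewrite unitmx_mul !gram.
pose B := - (invmx D *m (U *m X *m V^T)).
pose N := U^T *m V.
have e1 : 0 < e / (fnorm N + 1) by rewrite divr_gt0 // ltr_wpDl ?fnorm_ge0.
have [t [t0 te nrt]] :=
  exists_small_nonroot (monic_neq0 (char_poly_monic B)) e1.
exists (X + t *: N).
have rY : r *m (X + t *: N) = 0.
  rewrite mulmxDr rX add0r -scalemxAr mulmxA -[r]trmxK -trmx_mul Ur.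
  by rewrite trmx0 mul0mx scaler0.
split => //.
- rewrite addrC addKr fnormZ gtr0_norm //.
  move: te; rewrite ltr_pdivlMr ?ltr_wpDl ?fnorm_ge0 //.
  by apply: le_lt_trans; rewrite (ler_wpM2l (ltW t0)) // lerDl.
- by rewrite mulmxDl Xl add0r -scalemxAl -mulmxA Vl mulmx0 scaler0.
apply/eqP; rewrite eqn_leq; apply/andP; split.
  have /mulmx0_rank_max : r *m (X + t *: N) = 0 by [].
  by rewrite rank_rV r0 add1n ltnS.
have rkm : \rank (U *m (X + t *: N) *m V^T) = m.
  apply: mxrank_unit.
  have -> : U *m (X + t *: N) *m V^T = - (D *m (B - t%:M)).
    rewrite mulmxBr mulmxN mulKVmx // opprB opprK [X + _]addrC mul_mx_scalar.
    rewrite mulmxDr mulmxDl -scalemxAr -scalemxAl; congr (_ *: _ + _).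
    by rewrite /N /D !mulmxA.
  rewrite -scaleN1r unitmxZ ?unitrN1 // unitmx_mul uD /=.
  move: nrt; rewrite -eigenvalue_root_char /eigenvalue /eigenspace.
  by rewrite negbK kermx_eq0 row_free_unit.
rewrite -[leqLHS]rkm.
exact: leq_trans (mxrankM_maxl _ _) (mxrankM_maxr _ _).
Qed.

(* Any Z of rank at most m has a left null vector, and when Z is close to X it
   can be normalised as r + T with T = O(Z - X); then
   <r^T l, Z - X> = r Z l^T = - T (Z - X) l^T is quadratic in Z - X. *)
Lemma frechet_normal_rank m q (r : 'rV[R]_m.+1) (l : 'rV[R]_q)
    (X : 'M[R]_(m.+1, q)) :
  r *m r^T = 1%:M -> r *m X = 0 -> X *m l^T = 0 -> \rank X = m ->
  frechet_normal [set Z : 'M[R]_(m.+1, q) | (\rank Z <= m)%N] X (r^T *m l).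
Proof.
move=> rr rX Xl rkX; split=> [/=|e e0]; first by rewrite rkX.
have r0 := Theta_neq0 rr.
(* As [X] has rank [m] and [r X = 0], its columns span the orthogonal complement of [r], so the
   projection onto that complement factors through [X]. *)
have [G GE] : exists G, X *m G = 1%:M - r^T *m r.
  have sub : ((1%:M - r^T *m r) <= X^T)%MS.
    have PK : ((1%:M - r^T *m r)%R <= kermx r^T)%MS.
      by apply/sub_kermxP; rewrite mulmxBl mul1mx -mulmxA rr mulmx1 subrr.
    apply: submx_trans PK _.
    have XK : (X^T <= kermx r^T)%MS.
      by apply/sub_kermxP; rewrite -trmx_mul rX trmx0.
    have [_ /esym] := mxrank_leqif_sup XK.
    by rewrite mxrank_tr rkX mxrank_ker mxrank_tr rank_rV r0 subn1 /= eqxx => ->.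
  have [H /(congr1 trmx) HE] := submxP sub.
  exists H^T; move: HE; rewrite trmx_mul trmxK => <-.
  by rewrite linearB /= trmx1 trmx_mul trmxK.
pose g := fnorm G + 1; pose k := fnorm l + 1.
have g1 : 1 <= g by rewrite lerDr fnorm_ge0.
have k1 : 1 <= k by rewrite lerDr fnorm_ge0.
(* With [d = |Z - X|], the first bound gives [d g < 1/2], which yields [|T| <= 2 d g]; the second
   turns the final estimate [2 d g d k] into at most [e d]. *)
exists (Num.min (2 * g)^-1 (e / (2 * g * k))); split.
  by rewrite lt_min invr_gt0 divr_gt0 ?mulr_gt0 // ?mulr_gt0; lra.
move=> Z rkZ; rewrite lt_min => /andP[].
set d := fnorm (Z - X); have d0 : 0 <= d by exact: fnorm_ge0.
rewrite -div1r ltr_pdivlMr; last by lra.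
rewrite ltr_pdivlMr; last by rewrite !mulr_gt0 //; lra.
move=> dg dgk.
have [S S0 SZ] : exists2 S : 'rV[R]_m.+1, S != 0 & S *m Z = 0.
  have : kermx Z != 0.
    by rewrite kermx_eq0 /row_free neq_ltn ltnS rkZ.
  by move=> /rowV0Pn[S /sub_kermxP SZ S0]; exists S.
have SG : S = (frob S r) *: r - S *m (Z - X) *m G.
  rewrite mulmxBr SZ sub0r mulNmx opprK -mulmxA GE mulmxBr mulmx1 mulmxA.
  by rewrite mul_rV_tr mul_scalar_mx addrC subrK.
have bnd (T : 'rV[R]_m.+1) : fnorm (T *m (Z - X) *m G) <= fnorm T * d * g.
  apply: le_trans (fnormM _ _) _; apply: ler_pM; rewrite ?fnorm_ge0 ?fnormM //.
  by rewrite lerDl.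
(* Otherwise [S = - S (Z - X) G], whose norm is at most [|S| d g < |S|]. *)
have Sr0 : frob S r != 0.
  apply/eqP => h; move: SG; rewrite h scale0r sub0r => SG.
  have : fnorm S <= fnorm S * d * g by rewrite {1}SG fnormN.
  have : 0 < fnorm S.
    by rewrite lt0r fnorm_ge0 andbT; apply: contra S0 => /eqP/fnorm_eq0->.
  nra.
pose T := (frob S r)^-1 *: S - r.
have TZ : (T + r) *m Z = 0 by rewrite subrK -scalemxAl SZ scaler0.
have TG : T = - ((T + r) *m (Z - X) *m G).
  rewrite subrK /T [X in _ *: X - _]SG scalerBr scalerA mulVf // scale1r.
  by rewrite addrC addKr -!scalemxAl.
have r1 : fnorm r = 1 by rewrite /fnorm frobE rr mxtrace1 sqrtr1.
have Tle : fnorm T <= 2 * (d * g).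
  have : fnorm T <= (fnorm T + 1) * d * g.
    rewrite {1}TG fnormN; apply: le_trans (bnd _) _.
    by rewrite !ler_wpM2r ?(le_trans _ g1) // -r1 fnormD.
  have := fnorm_ge0 T; nra.
have -> : frob (r^T *m l) (Z - X) = frob (- (T *m (Z - X))) l.
  have -> : - (T *m (Z - X)) = r *m Z + T *m X.
    rewrite mulmxBr opprB addrC; congr (_ + _).
    by move/eqP: TZ; rewrite mulmxDl addrC addr_eq0 => /eqP->.
  rewrite frob_mull trmxK frobC mulmxBr rX subr0 frobDl.
  by rewrite [frob (T *m X) l]frobE -mulmxA Xl mulmx0 mxtrace0 addr0.
apply: le_trans (frob_le _ _) _; rewrite fnormN.
apply: (@le_trans _ _ (fnorm T * d * k)).
  by apply: ler_pM; rewrite ?fnorm_ge0 ?fnormM // lerDl.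
have : fnorm T * (d * k) <= 2 * (d * g) * (d * k).
  by rewrite ler_wpM2r // mulr_ge0 //; lra.
nra.
Qed.

Lemma limiting_normal_of_approx a b (S : set 'M[R]_(a, b)) X W :
  S X ->
  (forall e, 0 < e -> exists2 Y, fnorm (Y - X) < e & frechet_normal S Y W) ->
  limiting_normal S X W.
Proof.
move=> SX h; split=> //.
have /choice[xs hxs] (k : nat) :
    exists Y, fnorm (Y - X) < k.+1%:R^-1 /\ frechet_normal S Y W.
  by have [|Y] := h k.+1%:R^-1; [rewrite invr_gt0 | exists Y].
exists xs, (fun=> W); split; [|exact: cvg_mx_cst|by move=> k; have [] := hxs k].
move=> e e0.
have [K _ hK] := near_infty_natSinv_lt (PosNum e0).
by exists K => k /hK /=; apply: lt_trans; have [] := hxs k.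
Qed.

(** The rank of [X] may be below [m]; nearby matrices of rank exactly [m] keep the same annihilators
    [r] and [l], so the one matrix [r^T l] is a regular normal at all of them. *)
Lemma limiting_normal_rank m q (r : 'rV[R]_m.+1) (l : 'rV[R]_q)
    (X : 'M[R]_(m.+1, q)) :
  (m < q)%N -> r *m r^T = 1%:M -> r *m X = 0 -> X *m l^T = 0 ->
  limiting_normal [set Z : 'M[R]_(m.+1, q) | (\rank Z <= m)%N] X (r^T *m l).
Proof.
move=> mq rr rX Xl.
have r0 := Theta_neq0 rr.
apply: limiting_normal_of_approx => [/=|e e0].
  by have /mulmx0_rank_max := rX; rewrite rank_rV r0 add1n ltnS.
have [Y [YX rY Yl rkY]] := rank_perturbation mq r0 rX Xl e0.
by exists Y => //; apply: frechet_normal_rank.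
Qed.

End RankNormals.

(** * The adjoint, and the constraint as a linear system *)

Section Adjoint.
Variables (R : realType) (d p q : nat) (A : {linear 'cV[R]_d -> 'M[R]_(p, q)}).

Lemma frob_adjoint y X : frob (A y) X = frob y (adjoint A X).
Proof.
rewrite [in LHS](matrix_sum_delta y) linear_sum frobE mulmx_suml raddf_sum /=.
apply: eq_bigr => k _; rewrite !big_ord1 linearZ mxE -frobE.
by rewrite frobZl.
Qed.

(** Coefficient matrix of the constraint [r A(y) = 0] seen as a linear system in [y]; it is linear
    in [r], which makes the multiplier continuous in [r]. *)
Definition coef (r : 'rV[R]_p) : 'M[R]_(d, q) :=
  \matrix_(k, j) (r *m A (delta_mx k 0)) 0 j.

Lemma coef_is_linear : linear coef.
Proof.
by move=> t r s; apply/matrixP => k j; rewrite [LHS]mxE mulmxDl -scalemxAl !mxE.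
Qed.

HB.instance Definition _ :=
  GRing.isLinear.Build R 'rV[R]_p 'M[R]_(d, q) _ coef coef_is_linear.

Lemma tr_mul_coef y r : y^T *m coef r = r *m A y.
Proof.
rewrite [in RHS](matrix_sum_delta y) linear_sum mulmx_sumr.
apply/rowP => j; rewrite mxE summxE; apply: eq_bigr => k _.
by rewrite big_ord1 linearZ -scalemxAr !mxE.
Qed.

Lemma adjoint_rank1 r l : adjoint A (r^T *m l) = coef r *m l^T.
Proof.
apply/colP => k; rewrite !mxE frobC frob_mull trmxK /frob big_ord1.
by apply: eq_bigr => j _; rewrite !mxE mulrC.
Qed.

End Adjoint.

(** * Projection onto the feasible subspace, its multiplier and the value function *)

Section Projection.
Variables (R : realType) (d p q : nat) (A : {linear 'cV[R]_d -> 'M[R]_(p, q)}).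
Hypothesis adjoint_inj :
  forall (r : 'rV[R]_p) (l : 'rV[R]_q), r != 0 -> adjoint A (r^T *m l) = 0 -> l = 0.
Variable yhat : 'cV[R]_d.
Local Notation coef := (coef A).

Definition gram r : 'M[R]_q := (coef r)^T *m coef r.

(* The Lagrange multiplier of the problem defining Psi r, and its solution. *)
Definition mult r : 'rV[R]_q := r *m A yhat *m invmx (gram r).
Definition proj r : 'cV[R]_d := yhat - coef r *m (mult r)^T.

Definition psi r : R := 2^-1 * fnorm (proj r - yhat) ^+ 2.

Lemma unitmx_gram r : r != 0 -> gram r \in unitmx.
Proof.
move=> r0; rewrite /gram -{2}[coef r]trmxK; apply: gram_unitmx => u uc.
by apply: (adjoint_inj r0); rewrite adjoint_rank1 -[coef r]trmxK -trmx_mul uc trmx0.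
Qed.

Lemma mult_gram r : r != 0 -> mult r *m gram r = r *m A yhat.
Proof. by move=> r0; rewrite mulmxKV ?unitmx_gram. Qed.

Lemma proj_feasible r : r != 0 -> r *m A (proj r) = 0.
Proof.
move=> r0; rewrite -tr_mul_coef linearB /= mulmxBl tr_mul_coef -mult_gram //.
by rewrite trmx_mul trmxK mulmxA subrr.
Qed.

Lemma frob_coef r (l : 'rV[R]_q) y : frob (coef r *m l^T) y = frob l (r *m A y).
Proof. by rewrite frob_mull -tr_mul_coef -[RHS]frob_tr trmx_mul trmxK. Qed.

(** [proj r - yhat] lies in the range of [coef r], which is orthogonal to the differences of
    feasible points. *)
Lemma pythagoras r y : r != 0 -> r *m A y = 0 ->
  fnorm (y - yhat) ^+ 2 = fnorm (y - proj r) ^+ 2 + fnorm (proj r - yhat) ^+ 2.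
Proof.
move=> r0 ry.
have -> : y - yhat = (y - proj r) + (proj r - yhat) by rewrite addrA subrK.
set u := y - proj r; set v := proj r - yhat.
have uv : frob u v = 0.
  rewrite /v /proj addrC addKr frobNr frobC frob_coef.
  by rewrite linearB mulmxBr ry proj_feasible // subrr frob0r oppr0.
by clearbody u v; rewrite !sqr_fnorm frobDl !frobDr (frobC v u) uv addr0 add0r.
Qed.

Lemma PsiE r : r != 0 -> Psi A yhat r = (psi r)%:E.
Proof.
move=> r0; apply/eqP; rewrite eq_le; apply/andP; split.
  apply: ge_ereal_inf; exists (psi r)%:E => //.
  by exists (proj r) => //; exact: proj_feasible.
apply: le_ereal_inf_tmp => _ [y /= ry <-]; rewrite lee_fin /psi.
by rewrite ler_pM2l ?invr_gt0 // (pythagoras r0 ry) lerDr sqr_ge0.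
Qed.

Lemma minimizer_unique r y : r != 0 -> r *m A y = 0 ->
  (2^-1 * fnorm (y - yhat) ^+ 2)%:E = Psi A yhat r -> y = proj r.
Proof.
move=> r0 ry; rewrite PsiE // => -[]; rewrite /psi (pythagoras r0 ry) => h.
apply/eqP; rewrite -subr_eq0; apply/eqP/frob_eq0; rewrite -sqr_fnorm; lra.
Qed.

Lemma sqr_dist_proj r : r != 0 ->
  fnorm (proj r - yhat) ^+ 2 = frob (mult r) (r *m A yhat).
Proof.
move=> r0; rewrite /proj addrC addKr fnormN sqr_fnorm frob_coef.
by rewrite -tr_mul_coef trmx_mul trmxK -mulmxA mult_gram.
Qed.

(* Weak duality at [r0] with the optimal multiplier of [z]. *)
Lemma psi_sub_le z r0 : z != 0 -> r0 != 0 ->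
  psi z - psi r0 <=
  frob (z - r0) (mult z *m (A (yhat - coef r0 *m (mult z)^T))^T).
Proof.
move=> z0 r00; set l := mult z.
(* No duality gap at [z], because [l] is its optimal multiplier. *)
have psiz : psi z =
    frob l (z *m A yhat) - 2^-1 * frob (coef z *m l^T) (coef z *m l^T).
  rewrite /psi sqr_dist_proj // -/l.
  have -> : frob (coef z *m l^T) (coef z *m l^T) = frob l (z *m A yhat).
    by rewrite -sqr_dist_proj // /proj -/l addrC addKr fnormN sqr_fnorm.
  by move: (frob l _) => t; lra.
(* At [r0] the multiplier [l] only gives a lower bound; the gap is half the squared norm of
   [coef r0 (l - mult r0)^T]. *)
have psir : psi r0 >=
    frob l (r0 *m A yhat) - 2^-1 * frob (coef r0 *m l^T) (coef r0 *m l^T).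
  have := frob_ge0 (coef r0 *m l^T - coef r0 *m (mult r0)^T).
  rewrite !(frobDl, frobDr, frobNl, frobNr).
  rewrite (frobC (coef r0 *m (mult r0)^T) (coef r0 *m l^T)).
  have -> : frob (coef r0 *m (mult r0)^T) (coef r0 *m (mult r0)^T) = 2 * psi r0.
    rewrite /psi mulVKf ?pnatr_eq0 //.
    by rewrite /proj addrC addKr fnormN sqr_fnorm.
  have -> : frob (coef r0 *m l^T) (coef r0 *m (mult r0)^T) = frob l (r0 *m A yhat).
    by rewrite frob_coef -tr_mul_coef trmx_mul trmxK -mulmxA mult_gram.
  by move: (psi r0) (frob l _) (frob _ _) => t1 t2 t3; clear psiz; lra.
(* Expansion around [r0]; the part quadratic in [z - r0] enters the difference with a negative sign
   and is dropped. *)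
have zz : frob (coef z *m l^T) (coef z *m l^T) =
    frob (coef r0 *m l^T) (coef r0 *m l^T)
    + 2 * frob (coef (z - r0) *m l^T) (coef r0 *m l^T)
    + frob (coef (z - r0) *m l^T) (coef (z - r0) *m l^T).
  have -> : coef z = coef r0 + coef (z - r0) by rewrite -linearD addrC subrK.
  rewrite mulmxDl !(frobDl, frobDr).
  by rewrite (frobC (coef r0 *m l^T) (coef (z - r0) *m l^T)); ring.
have zA : frob l (z *m A yhat) =
    frob l (r0 *m A yhat) + frob l ((z - r0) *m A yhat).
  by rewrite -frobDr -mulmxDl addrC subrK.
have -> : frob (z - r0) (l *m (A (yhat - coef r0 *m l^T))^T) =
    frob l ((z - r0) *m A yhat) - frob (coef (z - r0) *m l^T) (coef r0 *m l^T).
  rewrite frobC frob_mulr trmxK linearB mulmxBr frobDr frobNr; congr (_ - _).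
  by rewrite frob_coef.
have := frob_ge0 (coef (z - r0) *m l^T); rewrite psiz zz zA.
move: (psi r0) (frob l _) (frob l (r0 *m _)) psir => t1 t2 t3.
move: (frob _ _) (frob _ (coef r0 *m _)) (frob (coef r0 *m _) _).
by move=> x y w; clear zz zA psiz; lra.
Qed.

Lemma cvg_mult xs x : x != 0 -> (forall k, xs k != 0) ->
  cvg_mx xs x -> cvg_mx (fun k => mult (xs k)) (mult x).
Proof.
move=> x0 xs0 hx; apply: cvg_mxM; first by apply: cvg_mxM hx (cvg_mx_cst _).
apply: cvg_invmx => [|k|]; rewrite ?unitmx_gram //.
apply: cvg_mxM; first apply: cvg_mx_tr; exact: cvg_mx_linear.
Qed.

(** * Subgradients of the value function restricted to the unit sphere *)

Lemma Psi_tildeE r : Theta r -> Psi_tilde A yhat r = (psi r)%:E.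
Proof.
by move=> Tr; rewrite /Psi_tilde /indicator asboolT // adde0 PsiE ?Theta_neq0.
Qed.

Lemma Psi_tilde_fin_num r : Psi_tilde A yhat r \is a fin_num -> Theta r.
Proof.
rewrite /Psi_tilde /indicator; case: asboolP => // _.
by case: (Psi _ _ _).
Qed.

(* [mult r *m (A (proj r))^T] is the gradient of Psi; a regular subgradient of
   its restriction to the sphere differs from it by a normal vector. The test
   points are the stereographic curve z = r + b (w - s c r), b = 2s/(1+s^2c),
   which stays on the sphere and leaves r in the tangent direction w. *)
Lemma frechet_subgrad_sphere r v : frechet_subgrad (Psi_tilde A yhat) r v ->
  mult r *m (A (proj r))^T = v - frob v r *: r.
Proof.
have quotient (e x y t a1 a2 a3 : R) :
    y + (t * a1 - e * (t * a2)) <= x -> x - y <= t * a3 -> 0 < t ->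
    a1 <= e * a2 + a3.
  by move=> h1 h2 t0; rewrite -(ler_pM2l t0); lra.
move=> [/Psi_tilde_fin_num Tr sub].
have r0 := Theta_neq0 Tr; have /Theta_frob rr := Tr.
set g := mult r *m _.
have gr : frob g r = 0.
  by rewrite /g frob_mulr trmxK proj_feasible // frob0r.
(* The residual to be shown zero; it is tangent to the sphere at [r] because [g] is. *)
have [w wE] : exists w, w = v - g - frob v r *: r by exists (v - g - frob v r *: r).
have wr : frob w r = 0.
  by rewrite wE !(frobDl, frobNl) frobZl gr rr; ring.
pose c := frob w w; have c0 : 0 <= c by exact: frob_ge0.
have vgw : frob v w - frob w g = c.
  rewrite /c [X in _ = frob X _]wE !(frobDl, frobNl) frobZl (frobC r) wr (frobC g).
  by ring.
pose s : nat -> R := harmonic.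
have s0 k : 0 < s k by rewrite invr_gt0.
have s1 k : s k <= 1 by rewrite invf_le1 ?ltr0n // ler1n.
have cvs : s k @[k --> \oo] --> (0 : R) by exact: cvg_harmonic.
pose b k := 2 * s k * (1 + s k * s k * c)^-1.
have D0 k : 0 < 1 + s k * s k * c.
  by rewrite ltr_pwDl // !mulr_ge0 // ltW.
have b0 k : 0 < b k by rewrite mulr_gt0 ?invr_gt0 // mulr_gt0.
have cvb : b k @[k --> \oo] --> (0 : R).
  rewrite [X in _ --> X](_ : 0 = 2 * 0 * (1 + 0 * 0 * c)^-1); last first.
    by rewrite mulr0 mul0r.
  apply: cvgM; first by apply: cvgM => //; exact: cvg_cst.
  apply: cvgV; first by rewrite !mul0r addr0 oner_eq0.
  apply: cvgD; first exact: cvg_cst.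
  by apply: cvgM; [exact: cvgM | exact: cvg_cst].
pose h k := w - (s k * c) *: r.
have cvh : cvg_mx h w.
  rewrite [X in cvg_mx _ X](_ : w = w - (0 * c) *: r); last first.
    by rewrite mul0r scale0r subr0.
  apply: cvg_mxD; first exact: cvg_mx_cst.
  apply/cvg_mxN/cvg_mxZ; last exact: cvg_mx_cst.
  by apply: cvgM => //; exact: cvg_cst.
pose z k := r + b k *: h k.
have cvz : cvg_mx z r.
  rewrite [X in cvg_mx _ X](_ : r = r + 0 *: w); last by rewrite scale0r addr0.
  by apply: cvg_mxD; [exact: cvg_mx_cst | exact: cvg_mxZ].
have Tz k : Theta (z k).
  apply/Theta_frob; rewrite /z /h !(frobDl, frobDr, frobNl, frobNr, frobZl, frobZr).
  rewrite (frobC r w) wr rr -/c /b; have := D0 k; move: (s k) => t Dt; field.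
  by rewrite gt_eqF.
have zE k : z k - r = b k *: h k by rewrite /z addrC addKr.
pose F k := mult (z k) *m (A (yhat - coef r *m (mult (z k))^T))^T.
have cvF : cvg_mx F g.
  have cvm : cvg_mx (fun k => mult (z k)) (mult r).
    by apply: cvg_mult => // k; exact: Theta_neq0.
  apply: cvg_mxM => //; apply/cvg_mx_tr/cvg_mx_linear.
  apply: cvg_mxD; first exact: cvg_mx_cst.
  by apply/cvg_mxN/cvg_mxM; [exact: cvg_mx_cst | exact: cvg_mx_tr].
have hle k : fnorm (h k) <= fnorm w + c.
  apply: le_trans (fnormD _ _) _; rewrite lerD2l fnormN fnormZ.
  rewrite /fnorm rr sqrtr1 mulr1 ger0_norm ?mulr_ge0 ?(ltW (s0 k)) //.
  by rewrite ler_piMl.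
(* The subgradient inequality and the duality bound at [z k] are divided by the step [b k]; the
   limit in [k] gives the claim. *)
have key e : 0 < e -> c <= e * (fnorm w + c).
  move=> e0; rewrite -[leLHS]vgw.
  have cv : frob v (h k) - frob (h k) (F k) @[k --> \oo] --> frob v w - frob w g.
    by apply: cvgB; apply: cvg_frob => //; exact: cvg_mx_cst.
  apply: (cvgr_to_le cv).
  have [dl [dl0 hdl]] := sub e e0; have [K hK] := cvz dl dl0.
  exists K => // k /= Kk; have := hdl _ (hK k Kk).
  rewrite !Psi_tildeE // lee_fin zE frobZr fnormZ gtr0_norm // => h1.
  have := psi_sub_le (Theta_neq0 (Tz k)) r0; rewrite zE frobZl -/(F k) => h2.
  rewrite lerBlDr; apply: (@le_trans _ _ (e * fnorm (h k) + frob (h k) (F k))).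
    exact: quotient h1 h2 (b0 k).
  by rewrite lerD2r (ler_wpM2l (ltW e0) (hle k)).
(* For [c > 0] the choice [e = c / (2 (|w| + c))] would give [c <= c / 2]. *)
have w0 : w = 0.
  apply: frob_eq0; rewrite -/c; apply/eqP; rewrite eq_le c0 andbT leNgt.
  apply/negP => cp; have D : 0 < 2 * (fnorm w + c).
    by rewrite mulr_gt0 // ltr_wpDl ?fnorm_ge0.
  have := key _ (divr_gt0 cp D).
  have -> : c / (2 * (fnorm w + c)) * (fnorm w + c) = c / 2.
    by field; have := fnorm_ge0 w; rewrite gt_eqF //; lra.
  lra.
by apply/esym/eqP; rewrite -subr_eq0 -w0 wE addrAC.
Qed.

(** In the identity for regular subgradients both sides converge along the defining sequence, the
    right one to 0 because the subgradients do. *)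
Lemma stationary_gradient r : limiting_subdiff (Psi_tilde A yhat) r 0 ->
  Theta r /\ mult r *m (A (proj r))^T = 0.
Proof.
move=> [/Psi_tilde_fin_num Tr [xs [vs [cx cv _ sub]]]]; split=> //.
have Tx k : Theta (xs k) by have [/Psi_tilde_fin_num] := sub k.
have cvm : cvg_mx (fun k => mult (xs k)) (mult r).
  by apply: cvg_mult => // [|k]; exact: Theta_neq0.
apply: (@cvg_mx_unique _ _ _ (fun k => mult (xs k) *m (A (proj (xs k)))^T)).
  apply: cvg_mxM => //; apply/cvg_mx_tr/cvg_mx_linear.
  apply: cvg_mxD; first exact: cvg_mx_cst.
  by apply/cvg_mxN/cvg_mxM; [exact: cvg_mx_linear | exact: cvg_mx_tr].
rewrite (_ : (fun k => _) = fun k => vs k - frob (vs k) (xs k) *: xs k); last first.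
  by apply/funext => k; exact: frechet_subgrad_sphere.
rewrite [X in cvg_mx _ X](_ : 0 = 0 - frob 0 r *: r); last first.
  by rewrite frob0l scale0r subr0.
by apply: cvg_mxD => //; apply/cvg_mxN/cvg_mxZ => //; exact: cvg_frob.
Qed.

End Projection.

(** * Pulling normals back along a linear map, and the claim for linear maps *)

Lemma frechet_normal_preimage (R : realType) d p q
    (A : {linear 'cV[R]_d -> 'M[R]_(p, q)}) (S : set 'M[R]_(p, q)) y W :
  frechet_normal S (A y) W -> frechet_normal [set x | S (A x)] y (adjoint A W).
Proof.
move=> [Sy h]; split=> // e e0; have [C C0 hC] := linear_bounded A.
(* [C] is a Lipschitz constant of [A]; dividing [e] and the radius by it compensates for passing to
   the image. *)
have [dl [dl0 hdl]] := h _ (divr_gt0 e0 C0).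
exists (dl / C); split; first exact: divr_gt0.
move=> x /= Sx; rewrite ltr_pdivlMr // mulrC => xy.
have := hC (x - y); rewrite linearB => Axy.
rewrite frobC -frob_adjoint linearB frobC.
apply: le_trans (hdl _ Sx (le_lt_trans Axy xy)) _.
by rewrite mulrAC ler_pdivrMr // -mulrA [_ * C]mulrC (ler_wpM2l (ltW e0) Axy).
Qed.

Lemma frechet_limiting_normal (R : realType) a b (S : set 'M[R]_(a, b)) x v :
  frechet_normal S x v -> limiting_normal S x v.
Proof.
move=> h; split; first by case: h.
by exists (fun=> x), (fun=> v); split => //; exact: cvg_mx_cst.
Qed.

(** One rank-one matrix [r^T l] serves both conclusions: when [A y] has rank [m] it is a regular
    normal at [A y] itself, so its image under the adjoint is a normal at [y]. *)
Lemma stationary_claim_linear (R : realType) d m q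
    (A : {linear 'cV[R]_d -> 'M[R]_(m.+1, q)}) :
  (m < q)%N ->
  (forall (r : 'rV[R]_m.+1) (l : 'rV[R]_q),
    r != 0 -> adjoint A (r^T *m l) = 0 -> l = 0) ->
  stationary_claim d m.+1 q m A.
Proof.
move=> mq inj yhat r y st ry ymin.
have [Tr grad] := stationary_gradient inj st.
have r0 := Theta_neq0 Tr.
have yE := minimizer_unique inj r0 ry ymin.
pose l := mult A yhat r.
have yl : A y *m l^T = 0 by rewrite yE -[LHS]trmxK trmx_mul trmxK grad trmx0.
have opt : y - yhat + adjoint A (r^T *m l) = 0.
  by rewrite adjoint_rank1 yE /proj -/l [yhat - _]addrC addrK addNr.
split; first by exists (r^T *m l) => //; exact: limiting_normal_rank.
move=> rky; exists (adjoint A (r^T *m l)) => //.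
apply: frechet_limiting_normal.
apply: (@frechet_normal_preimage _ _ _ _ A [set X | (\rank X <= m)%N]).
exact: frechet_normal_rank.
Qed.

(** * Hankel matrices with prescribed column offsets *)

Section GeneralHankel.
Variables (R : realType) (d m q : nat) (phi : nat -> nat).

(** [phi j] is the position in [y] at which column [j] starts, which covers single and concatenated
    Hankel matrices at once. *)
Definition gen_hankel (y : 'cV[R]_d) : 'M[R]_(m.+1, q) :=
  \matrix_(i, j) vget y (phi j + i).

Lemma vget_linear (t : R) (x y : 'cV[R]_d) k :
  vget (t *: x + y) k = t * vget x k + vget y k.
Proof. by rewrite /vget; case: insub => [i|]; rewrite ?mxE ?mulr0 ?addr0. Qed.

Lemma gen_hankel_is_linear : linear gen_hankel.
Proof. by move=> t x y; apply/matrixP => i j; rewrite !mxE vget_linear. Qed.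

HB.instance Definition _ :=
  GRing.isLinear.Build R 'cV[R]_d 'M[R]_(m.+1, q) _ gen_hankel gen_hankel_is_linear.

Hypothesis phi_mono : forall i j, (i < j < q)%N -> (phi i < phi j)%N.
Hypothesis phi_bound : forall (i : 'I_m.+1) (j : 'I_q), (phi j + i < d)%N.

(* The entry of the adjoint at (first index in the support of r) +
   phi (first index in the support of l) is a single product. *)
Lemma gen_hankel_adjoint_inj (r : 'rV[R]_m.+1) (l : 'rV[R]_q) :
  r != 0 -> adjoint gen_hankel (r^T *m l) = 0 -> l = 0.
Proof.
move=> r0 adj; apply/eqP/negPn/negP => l0.
have first n (u : 'rV[R]_n) : u != 0 ->
    exists2 i, u 0 i != 0 & forall j, u 0 j != 0 -> (i <= j)%N.
  move=> /rV0Pn[i ui].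
  have [k uk mk] :=
    @arg_minnP _ i (fun k => u 0 k != 0) (fun k : 'I_n => k : nat) ui.
  by exists k.
have [i0 ri0 mi0] := first _ _ r0.
have [j0 lj0 mj0] := first _ _ l0.
have /eqP := congr1 (fun M : 'cV_d => M (Ordinal (phi_bound i0 j0)) 0) adj.
rewrite !mxE /frob (bigD1 i0) //= (bigD1 j0) //=.
have vE i j : vget (delta_mx (Ordinal (phi_bound i0 j0)) 0 : 'cV[R]_d)
    (phi j + i) = ((phi j + i == phi j0 + i0)%N)%:R.
  rewrite /vget; case: insubP => [k kd kE|/= kd]; last first.
    by case: eqP => // E; move: kd; rewrite E phi_bound.
  by rewrite mxE andbT -val_eqE /= kE.
have mE i j : (r^T *m l) i j = r 0 i * l 0 j by rewrite mxE big_ord1 mxE.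
(* If [r] and [l] do not vanish at [i] and [j], then [i >= i0] and [j >= j0]; as [phi] is
   increasing, [phi j + i = phi j0 + i0] forces equality in both. *)
have zero (i : 'I_m.+1) (j : 'I_q) : (i, j) != (i0, j0) ->
    gen_hankel (delta_mx (Ordinal (phi_bound i0 j0)) 0) i j * (r^T *m l) i j = 0.
  move=> ij; rewrite mxE vE mE.
  have [->|/mi0 ii] := eqVneq (r 0 i) 0; first by rewrite mul0r mulr0.
  have [->|/mj0 jj] := eqVneq (l 0 j) 0; first by rewrite !mulr0.
  case: eqP => [E|]; last by rewrite mul0r.
  move: jj; rewrite leq_eqVlt => /orP[/eqP/val_inj jj|jj].
    move: E ij; rewrite -jj => /addnI/val_inj ->; by rewrite eqxx.
  have := @phi_mono j0 j; rewrite jj ltn_ord => /(_ isT); lia.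
rewrite !big1 ?addr0 => [|i ii|j jj].
- by rewrite mE !mxE vE eqxx mul1r mulf_eq0 (negPf ri0) (negPf lj0).
- by rewrite big1 // => j _; apply: zero; rewrite xpair_eqE negb_and ii.
- by apply: zero; rewrite xpair_eqE negb_and jj orbT.
Qed.

Lemma stationary_claim_gen_hankel :
  (m < q)%N -> stationary_claim d m.+1 q m gen_hankel.
Proof.
by move=> mq; apply: stationary_claim_linear => // r l; exact: gen_hankel_adjoint_inj.
Qed.

End GeneralHankel.

(** * The single and the block Hankel cases *)

Theorem theorem4p3 (R : realType) (n N r : nat) (rs : 'I_N -> nat) :
  (1 <= n)%N -> (1 <= N)%N -> (0 < r)%N ->
  (forall i, (0 < rs i)%N /\ (rs i <= r)%N) ->
  (r <= (n - 1) %/ 2)%N ->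
  (* case (a): d = n, m = r_i, p = r_i + 1, q = n - r_i, A = H_{r_i+1} *)
  (forall i : 'I_N,
     @stationary_claim R n (rs i).+1 (n - (rs i).+1 + 1) (rs i)
       (fun y : 'cV[R]_n => hankel (rs i).+1 y))
  /\
  (* case (b): d = N n, m = r, p = r + 1, q = N (n - r), A = block Hankel *)
  @stationary_claim R (N * n) r.+1 (N * (n - r)) r (block_hankel n N r).
Proof.
move=> n0 N0 r0 hrs; rewrite leq_divRL // => rn; split=> [i|].
  have [ri0 rir] := hrs i.
  have -> : (fun y : 'cV[R]_n => hankel (rs i).+1 y) = gen_hankel (rs i) _ id.
    by apply/funext => y; apply/matrixP => a b; rewrite !mxE addnC.
  apply: stationary_claim_gen_hankel => [a b /andP[]//|a b|]; last by lia.
  by have := ltn_ord a; have := ltn_ord b; lia.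
(* Each block has [n - r] columns but takes up [n] coordinates of [y]. *)
pose phi j := ((j %/ (n - r)) * n + j %% (n - r))%N.
have k0 : (0 < n - r)%N by lia.
have -> : block_hankel n N r = @gen_hankel R _ r _ phi.
  apply/funext => y; apply/matrixP => a b; rewrite !mxE.
  by rewrite [(a + _)%N]addnC addnA.
apply: stationary_claim_gen_hankel => [a b /andP[ab _]|a b|];
  rewrite /phi; last by nia.
  (* Within a block the remainder grows; a later block starts at least [n] further on, which exceeds
     every remainder. *)
  have := ltn_pmod a k0; have := ltn_pmod b k0.
  have := leq_div2r (n - r) (ltnW ab); rewrite leq_eqVlt => /orP[/eqP E|E].
    by have := divn_eq a (n - r); have := divn_eq b (n - r); rewrite E; lia.
  move: E; set u := (a %/ _)%N; set v := (b %/ _)%N => uv _ am.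
  have : (u.+1 * n <= v * n)%N by rewrite leq_mul2r uv orbT.
  by rewrite mulSn; lia.
(* Remainder plus row index is at most [(n - r - 1) + r < n], so the entry stays inside its own
   block. *)
have := ltn_ord a; have bm := ltn_pmod b k0.
have : (b %/ (n - r) < N)%N by rewrite ltn_divLR.
move=> bN; have : ((b %/ (n - r)).+1 * n <= N * n)%N by rewrite leq_mul2r bN orbT.
by rewrite mulSn; lia.
Qed.
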